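(* Let $Q\in\mathcal{B}(\mathcal{H})^{Id}$. Then the maximum $Q_{or}$ of $\{P\in\mathcal{P}(\mathcal{H}):P\preceq Q\}$ and the minimum $Q^{or}$ of $\{P\in\mathcal{P}(\mathcal{H}):Q\preceq P\}$ with respect to $\preceq$ exist, and: (i) $Q_{or}=P_{R(Q)\cap R(Q^{*})}$; (ii) $Q^{or}=I-(I-Q)_{or}$; (iii) $Q^{or}=P_{N(Q+Q^{*})^{\perp}}$.
   Context: $\mathcal{H}$ is a separable complex Hilbert space; $\mathcal{B}(\mathcal{H})^{Id}$ is the set of all bounded idempotent operators on $\mathcal{H}$ and $\mathcal{P}(\mathcal{H})$ the set of all orthogonal projections on $\mathcal{H}$. $N(T)$ and $R(T)$ denote the null space and range of $T$; $P_{\mathcal{M}}$ is the orthogonal projection onto a closed subspace $\mathcal{M}$. For idempotents $P,Q$ write $P\preceq Q$ if $PQ=QP=P$; this is a partial order on $\mathcal{B}(\mathcal{H})^{Id}$. For $Q\in\mathcal{B}(\mathcal{H})^{Id}$, $Q_{or}:=\max_{\preceq}\{P: P\preceq Q,\ P\in\mathcal{P}(\mathcal{H})\}$ and $Q^{or}:=\min_{\preceq}\{P: Q\preceq P,\ P\in\mathcal{P}(\mathcal{H})\}$. *)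

(* Defs.v *)
From HB Require Import structures.
From mathcomp Require Import all_boot all_order all_algebra.
From mathcomp Require Import all_classical all_reals all_analysis.
From mathcomp Require Import complex.
Import Order.TTheory GRing.Theory Num.Theory Num.Def numFieldNormedType.Exports.

Set Implicit Arguments.
Unset Strict Implicit.
Unset Printing Implicit Defensive.

Local Open Scope classical_set_scope.
Local Open Scope ring_scope.
Local Open Scope complex_scope.

(* The inner product is linear in its first argument and conjugate-linear in
   the second.  Separability is not part of the structure. *)
HB.mixin Record isHilbert (R : realType) H of CompleteNormedModule R[i] H := {
  inner : {dot H for conjC};
  sqr_normE : forall x : H, `|x| ^+ 2 = inner x x
}.

#[short(type="hilbertType")]
HB.structure Definition Hilbert (R : realType) :=
  {H of CompleteNormedModule R[i] H & isHilbert R H}.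

Definition separable (T : topologicalType) : Prop :=
  exists2 D : set T, countable D & dense D.

Section Operators.
Context {R : realType} {H : hilbertType R}.
Implicit Types (T P Q : H -> H) (M : set H).

Definition bounded_operator T : Prop :=
  linear T /\ exists c : R, forall x : H, `|T x| <= c%:C * `|x|.

(* For bounded T, such a z exists by the Riesz representation theorem, and it is
   unique because the inner product is definite; the default 0 is never used. *)
Definition adjoint T : H -> H := fun y =>
  xget 0 [set z | forall x, inner (T x) y = inner x z].

Definition null_space T : set H := [set x | T x = 0].

Definition orthocomp M : set H := [set x | forall y, M y -> inner x y = 0].

(* P_M, for M a closed subspace: by the projection theorem every x then has a
   unique decomposition x = y + (x - y) with y in M and x - y orthogonal to M,
   so the default 0 is never used. *)
Definition proj_onto M : H -> H := fun x =>
  xget 0 [set y | M y /\ orthocomp M (x - y)].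

Definition idempotents : set (H -> H) :=
  [set Q | bounded_operator Q /\ Q \o Q = Q].

Definition orthogonal_projections : set (H -> H) :=
  [set P | idempotents P /\ adjoint P = P].

Definition idem_le P Q : Prop := P \o Q = P /\ Q \o P = P.

Definition is_idem_max (A : set (H -> H)) P : Prop :=
  A P /\ forall P', A P' -> idem_le P' P.

Definition is_idem_min (A : set (H -> H)) P : Prop :=
  A P /\ forall P', A P' -> idem_le P P'.

Definition projections_below Q : set (H -> H) :=
  [set P | orthogonal_projections P /\ idem_le P Q].

Definition projections_above Q : set (H -> H) :=
  [set P | orthogonal_projections P /\ idem_le Q P].

(* Q_or and Q^or; the default 0 is used only if there is no maximum (resp.
   minimum), which is unique when it exists since idem_le is antisymmetric. *)
Definition lower_proj Q : H -> H :=
  xget (fun=> 0) (is_idem_max (projections_below Q)).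

Definition upper_proj Q : H -> H :=
  xget (fun=> 0) (is_idem_min (projections_above Q)).

End Operators.

(* Main.v *)
Require Import Defs.
From HB Require Import structures.
From mathcomp Require Import all_boot all_order all_algebra.
From mathcomp Require Import all_classical all_reals all_analysis.
From mathcomp Require Import complex.
From mathcomp Require Import ring lra.
Import Order.TTheory GRing.Theory Num.Theory Num.Def numFieldNormedType.Exports.

Set Implicit Arguments.
Unset Strict Implicit.
Unset Printing Implicit Defensive.

Local Open Scope classical_set_scope.
Local Open Scope ring_scope.

(* Let M = R(Q) /\ R(Q^* ).  An orthogonal projection S satisfies QS = S iff R(S)
   is contained in R(Q), and, taking adjoints, SQ = S iff R(S) is contained in
   R(Q^* ); hence P_M is the largest projection below Q.  Complementation
   P |-> I - P reverses the order, which gives (ii).  Finally, if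
   (Q + Q^* )x = 0 then y = Qx = - Q^*x is fixed by both Q and Q^*, so that
   <y, y> = <x, y> = - <y, y> and y = 0; thus N(Q + Q^* ) is the intersection of
   the ranges of I - Q and I - Q^*, which gives (iii).  The projection theorem
   and the Riesz representation theorem, needed for P_M and Q^* to exist, come
   from the parallelogram law. *)

Section HilbertSpace.
Context {R : realType} {H : hilbertType R}.
Implicit Types (x y z : H) (M : set H) (P Q S T : H -> H).

(** * Real-valued norm, Pythagoras and the Cauchy-Schwarz inequality *)

(** The norm of [H] takes values in [R[i]], which is only partially ordered; infima and real
    arithmetic need values in [R]. *)
Definition rnorm x : R := complex.Re `|x|.

Lemma rnormE x : (rnorm x)%:C%C = `|x|.
Proof. by rewrite RRe_real // normr_real. Qed.

Lemma rnorm_ge0 x : 0 <= rnorm x.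
Proof. by rewrite -lecR rnormE normr_ge0. Qed.

Lemma rnormD x y : rnorm (x + y) <= rnorm x + rnorm y.
Proof. by rewrite -lecR rmorphD /= !rnormE ler_normD. Qed.

Lemma rnormN x : rnorm (- x) = rnorm x.
Proof. by rewrite /rnorm normrN. Qed.

Lemma rnormZ (a : R[i]) x : (rnorm (a *: x))%:C%C = `|a| * (rnorm x)%:C%C.
Proof. by rewrite !rnormE normrZ. Qed.

Lemma rnorm_eq0 x : rnorm x = 0 -> x = 0.
Proof. by move=> x0; apply/normr0_eq0; rewrite -rnormE x0. Qed.

Lemma sqr_rnormE x : (rnorm x ^+ 2)%:C%C = inner x x.
Proof. by rewrite rmorphXn /= rnormE sqr_normE. Qed.

Lemma innerC x y : inner y x = (inner x y)^*.
Proof. by rewrite hermC /= expr0 mul1r. Qed.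

Lemma inner_eq0 x : inner x x = 0 -> x = 0.
Proof. by move/eqP; rewrite dnorm_eq0 => /eqP. Qed.

Lemma parallelogram x y :
  rnorm (x + y) ^+ 2 + rnorm (x - y) ^+ 2 = 2 * (rnorm x ^+ 2 + rnorm y ^+ 2).
Proof.
apply: complexI; rewrite rmorphM !rmorphD /= !sqr_rnormE.
by rewrite dnormD dnormB addrACA subrr addr0 rmorph1 mulrDl mul1r.
Qed.

(** The hypothesis says that [a *: y] is the projection of [x] onto the line of [y], so that
    [x - a *: y] is orthogonal to [y]. *)
Lemma pythagoras x y (a : R[i]) : a * inner y y = inner x y ->
  rnorm (x - a *: y) ^+ 2 + rnorm (a *: y) ^+ 2 = rnorm x ^+ 2.
Proof.
move=> ha; apply: complexI; rewrite rmorphD /= !sqr_rnormE -hnormDd ?subrK //.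
by rewrite linearZr_LR linearBl /= linearZl_LR /= ha subrr mulr0.
Qed.

Lemma cauchy_schwarz x y : `|inner x y| <= (rnorm x * rnorm y)%:C%C.
Proof.
have [->|y0] := eqVneq y 0.
  rewrite linear0r normr0 rmorphM /= mulr_ge0 ?lecR // ?ler0c ?rnorm_ge0 //.
have yy0 : inner y y != 0 by rewrite dnorm_eq0.
pose a := inner x y / inner y y.
have ha : a * inner y y = inner x y by rewrite /a divfK.
have h : rnorm (a *: y) <= rnorm x.
  rewrite -(@ler_pXn2r _ 2) ?nnegrE ?rnorm_ge0 //.
  by rewrite -(pythagoras ha) lerDr sqr_ge0.
rewrite -ha normrM -sqr_rnormE rmorphXn /= normrX rnormE normr_id expr2 mulrA.
rewrite -rnormE -rnormZ -rmorphM /= lecR ler_wpM2r ?rnorm_ge0 //.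
Qed.

(** * Closed subspaces and orthocomplements *)

Definition closed_subspace M :=
  [/\ M 0, forall (a : R[i]) x y, M x -> M y -> M (a *: x + y) & closed M].

Lemma mem_closureP M x :
  (forall e : R, 0 < e -> exists2 y, M y & rnorm (x - y) < e) -> closure M x.
Proof.
move=> h B /nbhs_ballP[e /= e0].
(* The radius is given in [R[i]]; being positive, it is real. *)
have [r re] : exists r, e = r%:C%C by apply/complex_realP/gtr0_real.
subst e; move: e0; rewrite ltcR => e0 sB.
have [y My yx] := h _ e0; exists y; split => //; apply: sB.
by rewrite -ball_normE /= -rnormE ltcR.
Qed.

Lemma closureP M x (e : R) :
  closure M x -> 0 < e -> exists2 y, M y & rnorm (x - y) < e.
Proof.
move=> Mx e0.
have /Mx[y [My]] : nbhs x (ball x e%:C%C) by apply: nbhsx_ballx; rewrite ltcR.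
by rewrite -ball_normE /= -rnormE ltcR => ?; exists y.
Qed.

(** A point x of the closure has zeros y of [f] arbitrarily near, and |f x| = |f (x - y)| is at most
    [c] times their distance. *)
Lemma closed_kernel (f : H -> R[i]) (c : R) : {morph f : x y / x - y} ->
  (forall x, `|f x| <= (c * rnorm x)%:C%C) -> closed [set x | f x = 0].
Proof.
move=> fB fc x cx; apply/eqP; rewrite -normr_eq0 eq_le normr_ge0 andbT.
have [r rE] : exists r, `|f x| = r%:C%C by apply/complex_realP/normr_real.
rewrite rE lecR; apply/ler_addgt0Pr => e e0; rewrite add0r.
(* [c] may be zero or negative, while [e / c'] has to be a positive radius. *)
pose c' := `|c| + 1; have c'0 : 0 < c' by rewrite ltr_wpDl.
have [y fy xy] := closureP cx (divr_gt0 e0 c'0).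
rewrite -lecR -rE -[f x]subr0 -fy -fB; apply: le_trans (fc _) _.
rewrite lecR; apply: (@le_trans _ _ (c' * rnorm (x - y))).
  by rewrite ler_wpM2r ?rnorm_ge0 // /c' (le_trans (ler_norm c)) ?lerDl.
by rewrite mulrC -ler_pdivlMr // ltW.
Qed.

Lemma closed_subspace_orthocomp M : closed_subspace (orthocomp M).
Proof.
split=> [y My|a x y ox oy z Mz|x cx y My]; first exact: linear0l.
  by rewrite linearDl /= linearZl_LR /= ox // oy // mulr0 addr0.
(* The orthocomplement is an intersection of kernels of functionals <., y>, each bounded by
   Cauchy-Schwarz. *)
apply: (@closed_kernel (fun x => inner x y) (rnorm y)).
- by move=> u v; rewrite linearBl.
- by move=> u; rewrite mulrC cauchy_schwarz.
- by apply: closure_subset cx => u; apply.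
Qed.

Lemma closed_subspaceI M N :
  closed_subspace M -> closed_subspace N -> closed_subspace (M `&` N).
Proof.
move=> [M0 Ml Mc] [N0 Nl Nc]; split; first by [].
  by move=> a x y [? ?] [? ?]; split; [exact: Ml|exact: Nl].
exact: closedI.
Qed.

(** * The projection theorem *)

(** Subtracting from [x] its projection onto the line of some y in [M] would, by Pythagoras, shorten
    it strictly unless that projection is 0. *)
Lemma orthocomp_minimizer M x : closed_subspace M ->
  (forall y, M y -> rnorm x <= rnorm (x - y)) -> orthocomp M x.
Proof.
move=> [M0 Ml _] xmin y My.
have [->|y0] := eqVneq y 0; first exact: linear0r.
have yy0 : inner y y != 0 by rewrite dnorm_eq0.
pose a := inner x y / inner y y.
have ha : a * inner y y = inner x y by rewrite /a divfK.
have Ma : M (a *: y) by rewrite -[a *: y]addr0; exact: Ml.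
rewrite -ha; suff /rnorm_eq0 ay0 : rnorm (a *: y) = 0.
  by rewrite -linearZl_LR /= ay0 linear0l.
apply/eqP; rewrite -sqrf_eq0 -(inj_eq (addrI (rnorm (x - a *: y) ^+ 2))).
rewrite (pythagoras ha) addr0 eq_le; have := xmin _ Ma.
rewrite -(@ler_pXn2r _ 2) ?nnegrE ?rnorm_ge0 // => ->.
by rewrite -(pythagoras ha) lerDl sqr_ge0.
Qed.

(** The midpoint of [y] and [z] is at distance at least [d] from [x], so the parallelogram law
    bounds the left side by 4(d + e)^2 - 4d^2 = 8de + 4e^2, where e^2 <= e. *)
Lemma minimizer_dist (d e : R) x y z : 0 <= d -> 0 <= e <= 1 ->
  rnorm (x - y) < d + e -> rnorm (x - z) < d + e ->
  d <= rnorm (x - 2^-1 *: (y + z)) ->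
  rnorm (y - z) ^+ 2 <= (8 * d + 4) * e.
Proof.
move=> d0 /andP[e0 e1] hy hz hm.
have two : (2 : R[i]) != 0 by rewrite pnatr_eq0.
have hs : rnorm ((x - y) + (x - z)) = 2 * rnorm (x - 2^-1 *: (y + z)).
  apply: complexI; rewrite rmorphM /= rmorph_nat -[X in X * _]normr_nat -rnormZ.
  rewrite scalerBr scalerA mulfV // scale1r scaler_nat mulr2n.
  by rewrite addrACA -opprD.
have hd : (x - z) - (x - y) = y - z by rewrite opprB addrC addrA subrK.
have := parallelogram (x - z) (x - y); rewrite hd [_ + (x - y)]addrC hs.
have := rnorm_ge0 (x - y); have := rnorm_ge0 (x - z).
move: hy hz hm; move: (rnorm _) (rnorm _) (rnorm _) (rnorm _) => a b c f.
move=> ha hb hc a0 b0; nra.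
Qed.

(** The points of [M] at distance less than [d + e] from [x] generate, for e > 0, a Cauchy filter;
    by completeness it converges, and its limit attains the distance [d]. *)
Lemma exists_projection M x : closed_subspace M ->
  exists2 y, M y & orthocomp M (x - y).
Proof.
move=> cM; have [M0 Ml Mc] := cM.
have [D0 Dlb] : has_inf [set rnorm (x - y) | y in M].
  split; first by exists (rnorm (x - 0)); exists 0.
  by exists 0 => _ [y _ <-]; exact: rnorm_ge0.
set D := image _ _ in D0 Dlb; pose d := inf D.
have dle y : M y -> d <= rnorm (x - y) by move=> My; apply: ge_inf => //; exists y.
have d0 : 0 <= d by apply: lb_le_inf => // _ [y _ <-]; exact: rnorm_ge0.
pose A (e : R) := [set y | M y /\ rnorm (x - y) < d + e].
have An e : 0 < e -> exists y, A e y.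
  move=> e0; have [_ [y My <-] xy] := inf_adherent e0 (conj D0 Dlb).
  by exists y.
have AS (e e' : R) : e <= e' -> A e `<=` A e'.
  by move=> ee y [My xy]; split => //; apply: lt_le_trans xy _; rewrite lerD2l.
pose F := filter_from [set e : R | 0 < e] A.
have FF : ProperFilter F.
  apply: filter_from_proper; last by move=> e /An.
  apply: filter_from_filter; first by exists 1; rewrite /= ltr01.
  move=> e e' /= e0 e'0; exists (Num.min e e'); first by rewrite /= lt_min e0.
  by move=> y Ay; split; apply: AS Ay; rewrite ge_min lexx ?orbT.
have /cauchy_cvg Fc : cauchy F.
  apply: cauchy_exP => e' e'0.
  have [e eE] : exists e, e' = e%:C%C by apply/complex_realP/gtr0_real.
  move: e'0; rewrite {}eE {e'} ltcR => e0.
  have k0 : 0 < 8 * d + 4 by rewrite ltr_wpDl // mulr_ge0.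
  (* Chosen so that (8d + 4)h <= e^2 / 2 < e^2; the cap 1 is required by [minimizer_dist]. *)
  pose h := Num.min 1 (e ^+ 2 / 2 / (8 * d + 4)).
  have h0 : 0 < h by rewrite lt_min ltr01 !divr_gt0 ?exprn_gt0.
  have [y [My xy]] := An _ h0; exists y, h => // z [Mz xz].
  rewrite -ball_normE /= -rnormE ltcR -(@ltr_pXn2r _ 2) ?nnegrE ?rnorm_ge0 ?ltW //.
  apply: le_lt_trans (minimizer_dist d0 _ xy xz _) _.
  - by rewrite ltW //= ge_min lexx.
  - apply: dle; rewrite -[_ *: _]addr0; apply: (Ml) => //.
    by rewrite -[y]scale1r; exact: Ml.
  - have : h <= e ^+ 2 / 2 / (8 * d + 4) by rewrite ge_min lexx orbT.
    rewrite ler_pdivlMr // mulrC => /le_lt_trans; apply.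
    by rewrite ltr_pdivrMr // ltr_pMr ?exprn_gt0 // ltr1n.
have near_lim e : 0 < e -> exists2 z, A e z & rnorm (z - lim F) < e.
  move=> e0.
  have [e' /= e'0 sB] : F (ball (lim F) e%:C%C).
    by apply: Fc; apply: nbhsx_ballx; rewrite ltcR.
  have m0 : 0 < Num.min e e' by rewrite lt_min e0.
  have [z Az] := An _ m0.
  exists z; first by apply: AS Az; rewrite ge_min lexx.
  have /sB : A e' z by apply: AS Az; rewrite ge_min lexx orbT.
  by rewrite -ball_normE /= -rnormE ltcR -rnormN opprB.
have ML : M (lim F).
  apply: Mc; apply: mem_closureP => e /near_lim[z [Mz _] ze].
  by exists z => //; rewrite -rnormN opprB.
exists (lim F) => //.
(* Every competitor [lim F + y] lies in [M], hence at distance at least [d]; it remains to bound the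
   distance of [lim F] by [d]. *)
apply: orthocomp_minimizer => // y My; rewrite -addrA -opprD.
apply: le_trans (dle _ _); last first.
  by rewrite -[lim F]scale1r; exact: Ml.
apply/ler_addgt0Pr => e e0.
have e20 : 0 < e / 2 by rewrite divr_gt0.
have [z [Mz xz] zl] := near_lim _ e20.
have := rnormD (x - z) (z - lim F); rewrite addrA subrK; lra.
Qed.

Lemma proj_ontoP M x : closed_subspace M ->
  M (proj_onto M x) /\ orthocomp M (x - proj_onto M x).
Proof.
move=> /(exists_projection x)[y My oy]; rewrite /proj_onto.
by case: xgetP => [_ _ //|/(_ y)]; case.
Qed.

Lemma proj_onto_unique M x y : closed_subspace M ->
  M y -> orthocomp M (x - y) -> proj_onto M x = y.
Proof.
move=> cM My oy; have [Mp op] := proj_ontoP x cM.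
have [_ Ml _] := cM; apply/esym/eqP; rewrite -subr_eq0; apply/eqP.
set p := proj_onto M x in Mp op *; apply: inner_eq0.
have Myp : M (y - p) by rewrite addrC -scaleN1r; exact: Ml.
have yp : y - p = (x - p) - (x - y) by rewrite opprB [RHS]addrC addrA subrK.
by rewrite {1}yp linearBl /= op // oy // subrr.
Qed.

(** * Riesz representation and adjoints *)

Lemma bounded_operatorE T : bounded_operator T ->
  exists g : {linear H -> H}, T = g.
Proof.
move=> [lT _].
by exists (HB.pack T (GRing.isLinear.Build _ _ _ _ T lT) : {linear H -> H}).
Qed.

(** For [w] orthogonal to the kernel with f w nonzero, x - (f x / f w) w lies in the kernel, so <x,
    w> = (f x / f w) <w, w>; this is solved for f x. *)
Lemma riesz (f : H -> R[i]) (c : R) : scalar f ->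
  (forall x, `|f x| <= (c * rnorm x)%:C%C) ->
  exists z, forall x, f x = inner x z.
Proof.
move=> lf fc.
have fB : {morph f : x y / x - y}.
  by move=> x y; rewrite addrC -scaleN1r lf mulN1r addrC.
have f0 : f 0 = 0 by rewrite -[0 in LHS](subrr 0) fB subrr.
have cK : closed_subspace [set x | f x = 0].
  split=> [//|a x y /= fx fy|]; last exact: closed_kernel fc.
  by rewrite lf fx fy mulr0 addr0.
have [[x0 fx0]|nf] := pselect (exists x, f x != 0); last first.
  exists 0 => x; rewrite linear0r; apply/eqP; apply: contra_notT nf.
  by exists x.
have [y /= fy oy] := exists_projection x0 cK; set w := x0 - y in oy.
have fw : f w != 0 by rewrite fB fy subr0.
have ww : inner w w != 0.
  by rewrite dnorm_eq0; apply: contraNneq fw => ->; rewrite f0.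
(* The conjugate offsets the conjugate-linearity of the second argument. *)
exists ((f w / inner w w)^* *: w) => x.
have : inner w (x - (f x / f w) *: w) = 0.
  by apply: oy; rewrite /= addrC -scaleNr lf mulNr divfK // addNr.
rewrite innerC => /eqP; rewrite conjC_eq0 linearBl subr_eq0 => /eqP.
rewrite linearZl_LR linearZr_LR /= conjCK => ->.
by rewrite [_ / inner w w]mulrC -mulrA !mulrA; field; rewrite fw.
Qed.

Lemma adjointP T x y : bounded_operator T ->
  inner (T x) y = inner x (adjoint T y).
Proof.
move=> bT; have [g gE] := bounded_operatorE bT; have [_ [c Tc]] := bT.
have [z zE] : exists z, forall u, inner (T u) y = inner u z.
  apply: (@riesz _ (c * rnorm y)) => [a u v|u].
    by rewrite gE linearP linearPl.
  apply: le_trans (cauchy_schwarz _ _) _.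
  rewrite lecR mulrAC ler_wpM2r ?rnorm_ge0 //.
  by rewrite -lecR rmorphM /= !rnormE.
rewrite /adjoint; case: xgetP => [_ _ //|/(_ z)]; case; exact: zE.
Qed.

Lemma inner_ext x y : (forall z, inner z x = inner z y) -> x = y.
Proof.
move=> xy; apply/eqP; rewrite -subr_eq0; apply/eqP/inner_eq0.
by rewrite linearBr /= xy subrr.
Qed.

Lemma adjoint_unique T S : (forall x y, inner (T x) y = inner x (S y)) ->
  adjoint T = S.
Proof.
move=> TS; apply/funext => y; apply: inner_ext => z.
rewrite /adjoint; case: xgetP => [_ _ <-|/(_ (S y))]; first exact: TS.
by case=> x; exact: TS.
Qed.

(** * Orthogonal projections, complements and the order *)

(** Linearity and idempotence follow from uniqueness of the decomposition, self-adjointness from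
    <Px, y> = <Px, Py> = <x, Py>, and the bound 1 from Pythagoras. *)
Lemma proj_onto_orthogonal_projection M : closed_subspace M ->
  orthogonal_projections (proj_onto M).
Proof.
move=> cM; have [M0 Ml _] := cM; set P := proj_onto M.
have PM x : M (P x) by have [] := proj_ontoP x cM.
have PO x : orthocomp M (x - P x) by have [] := proj_ontoP x cM.
have [_ Ol _] := closed_subspace_orthocomp M.
have lP : linear P.
  move=> a x y; apply: proj_onto_unique => //; first exact: Ml.
  rewrite opprD addrACA -scalerBr; exact: Ol.
split; last first.
  apply: adjoint_unique => x y.
  have xE : inner (P x) (y - P y) = 0 by rewrite innerC PO ?conjC0.
  have := PO x _ (PM y); rewrite linearBl => /eqP; rewrite subr_eq0 => /eqP ->.
  by move: xE; rewrite linearBr => /eqP; rewrite subr_eq0 => /eqP.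
split; last first.
  apply/funext => x; apply: proj_onto_unique => //=.
  by rewrite subrr => y _; exact: linear0l.
split=> //; exists 1 => x; rewrite mul1r -!rnormE lecR.
rewrite -(@ler_pXn2r _ 2) ?nnegrE ?rnorm_ge0 //.
have := @pythagoras x (P x) 1; rewrite scale1r mul1r => <-.
  by rewrite lerDr sqr_ge0.
by have /eqP := PO x _ (PM x); rewrite linearBl subr_eq0 => /eqP.
Qed.

Lemma projection_inner P x y : orthogonal_projections P ->
  inner (P x) y = inner x (P y).
Proof. by move=> [[bP _] aP]; rewrite adjointP // aP. Qed.

Lemma idempotent_compl Q : idempotents Q -> idempotents (idfun \- Q).
Proof.
move=> [bQ QQ]; have [g gE] := bounded_operatorE bQ; have [_ [c Qc]] := bQ.
split; first split.
- by move=> a x y; rewrite /= gE linearP /= opprD addrACA -scalerBr.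
- exists (1 + c) => x /=; apply: le_trans (ler_normB _ _) _.
  by rewrite rmorphD rmorph1 mulrDl mul1r lerD2l.
- apply/funext => x /=; rewrite {2}gE linearB /= -gE.
  by rewrite -[Q (Q x)]/((Q \o Q) x) QQ subrr subr0.
Qed.

Lemma adjoint_compl Q : bounded_operator Q ->
  adjoint (idfun \- Q) = idfun \- adjoint Q.
Proof.
move=> bQ; apply: adjoint_unique => x y.
by rewrite /= linearBl linearBr /= adjointP.
Qed.

Lemma orthogonal_projection_compl P :
  orthogonal_projections P -> orthogonal_projections (idfun \- P).
Proof.
move=> [iP aP]; split; first exact: idempotent_compl.
by rewrite adjoint_compl ?aP; case: iP.
Qed.

Lemma complK (P : H -> H) : idfun \- (idfun \- P) = P.
Proof. by apply/funext => x /=; rewrite subKr. Qed.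

(** (I - Q)(I - P) = I - P - Q + QP, which is I - Q when QP = P; likewise in the other order. *)
Lemma idem_le_compl P Q : bounded_operator P -> bounded_operator Q ->
  idem_le P Q -> idem_le (idfun \- Q) (idfun \- P).
Proof.
move=> bP bQ [PQ QP].
have [p pE] := bounded_operatorE bP; have [q qE] := bounded_operatorE bQ.
split; apply/funext => x /=.
  by rewrite qE linearB /= -qE -[Q (P x)]/((Q \o P) x) QP opprB addrA subrK.
by rewrite pE linearB /= -pE -[P (Q x)]/((P \o Q) x) PQ subrr subr0.
Qed.

Lemma idem_le_anti P Q : idem_le P Q -> idem_le Q P -> P = Q.
Proof. by move=> [PQ _] [_ QP]; rewrite -[LHS]PQ. Qed.

Lemma range_idempotent Q : Q \o Q = Q -> range Q = [set x | Q x = x].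
Proof.
move=> QQ; apply/seteqP; split=> [_ [x _ <-]|x Qx]; last by exists x.
by rewrite /= -[Q (Q x)]/((Q \o Q) x) QQ.
Qed.

Lemma adjoint_idempotent Q : idempotents Q -> adjoint Q \o adjoint Q = adjoint Q.
Proof.
move=> [bQ QQ]; apply/funext => y; apply: inner_ext => x /=.
by rewrite -!adjointP // -[Q (Q x)]/((Q \o Q) x) QQ.
Qed.

(* The ranges of [Q] and [Q^*] are fixed-point sets, hence the orthocomplements
   of the ranges of [I - Q^*] and [I - Q]. *)
Lemma closed_subspace_ranges Q : idempotents Q ->
  closed_subspace (range Q `&` range (adjoint Q)).
Proof.
move=> iQ; have [bQ QQ] := iQ.
have orthocomp_fixE (S T : H -> H) :
    (forall x y, inner (S x) y = inner x (T y)) ->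
    [set x | S x = x] = orthocomp [set y - T y | y in setT].
  move=> ST; apply/seteqP; split=> [x /= Sx _ [y _ <-]|x ox].
    by rewrite linearBr /= -ST Sx subrr.
  (* For u = Sx - x, <u, u> = <x, Tu - u>, which vanishes since [x] is orthogonal to u - Tu. *)
  apply/eqP; rewrite -subr_eq0; apply/eqP/inner_eq0.
  set u := S x - x; rewrite {1}/u linearBl /= ST -linearBr -opprB linearNr /=.
  by rewrite ox ?oppr0 //; exists u.
apply: closed_subspaceI.
  rewrite range_idempotent // (orthocomp_fixE _ (adjoint Q)).
    exact: closed_subspace_orthocomp.
  by move=> x y; rewrite adjointP.
rewrite range_idempotent ?adjoint_idempotent // (orthocomp_fixE _ Q).
  exact: closed_subspace_orthocomp.
by move=> x y; rewrite innerC -adjointP // [RHS]innerC.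
Qed.

(** * The maximum below and the minimum above an idempotent *)

Lemma is_idem_max_proj Q : idempotents Q ->
  is_idem_max (projections_below Q) (proj_onto (range Q `&` range (adjoint Q))).
Proof.
move=> iQ; have [bQ QQ] := iQ.
have cM := closed_subspace_ranges iQ; set M := _ `&` _ in cM *.
have ME x : M x <-> Q x = x /\ adjoint Q x = x.
  by rewrite /M !range_idempotent ?adjoint_idempotent.
have oP := proj_onto_orthogonal_projection cM; set P := proj_onto M in oP *.
have PM x : M (P x) by have [] := proj_ontoP x cM.
have Pfix x : M x -> P x = x.
  by move=> Mx; apply: proj_onto_unique => //; rewrite subrr => y _; exact: linear0l.
split; first split=> //.
  split; apply/funext => x /=; last by have /ME[] := PM x.
  (* To get PQ = P, self-adjointness moves [P] onto [y], and [adjoint Q] fixes [P y]. *)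
  apply: inner_ext => y; rewrite -!(projection_inner _ _ oP) innerC.
  by rewrite adjointP //; have /ME[_ ->] := PM y; rewrite -innerC.
move=> S [oS [SQ QS]].
have SM x : M (S x).
  apply/ME; split; first by rewrite -[Q (S x)]/((Q \o S) x) QS.
  apply: inner_ext => y; rewrite -adjointP // -!(projection_inner _ _ oS).
  by rewrite -[S (Q y)]/((S \o Q) y) SQ.
split; apply/funext => x /=; last exact: Pfix.
(* SP = S is the adjoint of PS = S, which holds because [P] fixes [M]. *)
apply: inner_ext => y; rewrite -(projection_inner _ _ oS) -(projection_inner _ _ oP).
by rewrite Pfix // (projection_inner _ _ oS).
Qed.

Lemma is_idem_max_lower_proj Q P :
  is_idem_max (projections_below Q) P -> lower_proj Q = P.
Proof.
move=> mP; rewrite /lower_proj; case: xgetP => [S _ mS|/(_ P)//].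
by apply: idem_le_anti; [apply: mP.2; case: mS|apply: mS.2; case: mP].
Qed.

Lemma is_idem_min_upper_proj Q P :
  is_idem_min (projections_above Q) P -> upper_proj Q = P.
Proof.
move=> mP; rewrite /upper_proj; case: xgetP => [S _ mS|/(_ P)//].
by apply: idem_le_anti; [apply: mS.2; case: mP|apply: mP.2; case: mS].
Qed.

(** The order-reversing involution S |-> I - S preserves orthogonal projections, so it exchanges
    those below I - Q with those above Q. *)
Lemma is_idem_min_compl Q P : idempotents Q ->
  is_idem_max (projections_below (idfun \- Q)) P ->
  is_idem_min (projections_above Q) (idfun \- P).
Proof.
move=> iQ [[oP PQ] maxP]; have bP := oP.1.1; have bQ := iQ.1.
have [bQ' _] := idempotent_compl iQ.
split; first split; first exact: orthogonal_projection_compl.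
  by rewrite -[Q]complK; exact: idem_le_compl.
move=> S [oS QS]; have oS' := orthogonal_projection_compl oS.
rewrite -[S]complK; apply: idem_le_compl => //; first exact: oS'.1.1.
by apply: maxP; split=> //; apply: idem_le_compl => //; exact: oS.1.1.
Qed.

Lemma null_space_add_adjoint Q : idempotents Q ->
  null_space (Q \+ adjoint Q) =
  range (idfun \- Q) `&` range (adjoint (idfun \- Q)).
Proof.
move=> iQ; have iQ' := idempotent_compl iQ; have [bQ QQ] := iQ.
rewrite !range_idempotent ?adjoint_idempotent ?adjoint_compl //; last first.
  exact: iQ'.2.
have sub0E x y : x - y = x <-> y = 0.
  by split=> [/eqP|->]; rewrite ?subr0 // subr_eq addrC -subr_eq subrr => /eqP.
(* By [sub0E], lying in both ranges means that [Q] and [adjoint Q] both vanish at [x]. *)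
apply/seteqP; split=> x /=; last first.
  by rewrite /null_space /= => -[/sub0E -> /sub0E ->]; rewrite addr0.
rewrite /null_space /= => Sx; set y := Q x.
have ay : adjoint Q x = - y by apply/eqP; rewrite -addr_eq0 addrC Sx.
have Qy : Q y = y by rewrite -[LHS]/((Q \o Q) x) QQ.
have ady : adjoint Q y = y.
  have yE : y = - adjoint Q x by rewrite ay opprK.
  apply: inner_ext => z; rewrite -adjointP // yE !linearNr /= -!adjointP //.
  by rewrite -[Q (Q z)]/((Q \o Q) z) QQ.
have y1 : inner y y = inner x y by rewrite {1}/y adjointP // ady.
(* Writing y = Qy moves the operator onto [x], where [adjoint Q x = - y] brings the opposite
   sign. *)
have y2 : inner y y = - inner x y.
  by rewrite [inner x y]innerC -{3}Qy adjointP // ay linearNr rmorphN opprK [LHS]innerC.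
have y0 : y = 0.
  apply: inner_eq0; apply/eqP; by rewrite -eqNr {1}y1 -y2.
by split; apply/sub0E; rewrite ?ay ?y0 ?oppr0 // -/y y0.
Qed.

(** The remainder x - (x - Px) = Px lies in [M], hence is orthogonal to [orthocomp M]. *)
Lemma proj_onto_orthocomp M : closed_subspace M ->
  proj_onto (orthocomp M) = idfun \- proj_onto M.
Proof.
move=> cM; apply/funext => x; have [Mp op] := proj_ontoP x cM.
apply: proj_onto_unique => //=; first exact: closed_subspace_orthocomp.
by rewrite subKr => y My; rewrite innerC My ?conjC0.
Qed.

End HilbertSpace.

Theorem proposition3p3 (R : realType) (H : hilbertType R) (sepH : separable H)
    (Q : H -> H) (idQ : idempotents Q) :
  (exists P, is_idem_max (projections_below Q) P) /\
  (exists P, is_idem_min (projections_above Q) P) /\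
  lower_proj Q = proj_onto (range Q `&` range (adjoint Q)) /\
  upper_proj Q = idfun \- lower_proj (idfun \- Q) /\
  upper_proj Q = proj_onto (orthocomp (null_space (Q \+ adjoint Q))).
Proof.
have iQ' := idempotent_compl idQ.
have maxQ := is_idem_max_proj idQ; have maxQ' := is_idem_max_proj iQ'.
have minQ := is_idem_min_compl idQ maxQ'.
have lowQ' := is_idem_max_lower_proj maxQ'.
split; first by exists (proj_onto (range Q `&` range (adjoint Q))).
split; first by eexists; exact: minQ.
split; first exact: is_idem_max_lower_proj.
(* Both sides of (ii) become I minus the projection onto the intersection of the ranges of I - Q and
   its adjoint; for (iii) that intersection is the null space. *)
rewrite lowQ' (is_idem_min_upper_proj minQ); split=> //.
rewrite null_space_add_adjoint // proj_onto_orthocomp //.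
exact: closed_subspace_ranges.
Qed.
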